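(* Let $G$ be a connected unweighted graph of order $n\ge2$ and let $e$ be an edge of $G$ such that $H=G-\{e\}$ is connected. Then $$K(H)\ \ge\ K(G)+\frac12-\frac{2}{\phi(G)^2}.$$
   Context: Graphs are finite, simple, connected and undirected; unweighted means all edge weights are $1$. For $S\subseteq V$, $\operatorname{vol}(S)$ is the sum of degrees of vertices in $S$ and $\bar S=V\setminus S$. The conductance of $G$ is $$\phi(G)=\min_{\emptyset\ne S\subsetneq V}\frac{|\{\text{edges between } S \text{ and } \bar S\}|}{\min(\operatorname{vol}(S),\operatorname{vol}(\bar S))}.$$ For a graph $G$ with $n$ vertices, adjacency matrix $A$ and diagonal degree matrix $D$, Kemeny's constant is $K(G)=\sum_i\pi_i m_{ji}-1$ for the random walk with transition matrix $D^{-1}A$, where $\pi$ is the stationary distribution and $m_{ji}$ the mean first passage time from $j$ to $i$ (with $m_{jj}$ the mean first return time); this does not depend on $j$, and it is known that $K(G)=\sum_{j=1}^{n-1}\frac{1}{\mu_j}$, where $\mu_1\ge\cdots\ge\mu_{n-1}>\mu_n=0$ are the eigenvalues of the normalized Laplacian $I-D^{-1/2}AD^{-1/2}$. $G-\{e\}$ is the graph on the same vertex set with edge $e$ removed. *)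

(* Defs.v *)
From mathcomp Require Import all_boot all_order all_algebra.
From mathcomp Require Import all_classical all_reals all_analysis.

Set Implicit Arguments.
Unset Strict Implicit.
Unset Printing Implicit Defensive.

Import Order.TTheory GRing.Theory Num.Theory.

Local Open Scope ring_scope.

(* A finite simple graph on V is a symmetric irreflexive relation g : rel V. *)
Section Graph.
Variables (V : finType) (g : rel V).

Definition connected_graph : Prop := forall x y : V, connect g x y.

Definition deg (x : V) : nat := #|[set y | g x y]|.

Definition vol (S : {set V}) : nat := (\sum_(x in S) deg x)%N.

(* An edge between S and its complement is counted exactly once, oriented from
   S to ~: S. *)
Definition cut (S : {set V}) : nat :=
  #|[set p : V * V | [&& p.1 \in S, p.2 \notin S & g p.1 p.2]]|.

Definition remove_edge (u v : V) : rel V :=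
  fun x y => g x y && ([set x; y] != [set u; v]).

End Graph.

Definition cut_ratio (R : realType) (V : finType) (g : rel V) (S : {set V}) : R :=
  (cut g S)%:R / (minn (vol g S) (vol g (~: S)))%:R.

(* The infimum is over a finite set, nonempty as soon as 1 < #|V|, so it is a
   minimum. *)
Definition conductance (R : realType) (V : finType) (g : rel V) : R :=
  inf [set cut_ratio R g S | S in
        [set S : {set V} | S != finset.set0 /\ S != finset.setT]]%classic.

Section MarkovChain.
Variables (R : realType) (V : finType) (P : V -> V -> R).

Definition is_stationary (p : {ffun V -> R}) : Prop :=
  [/\ forall i, 0 <= p i, \sum_i p i = 1 &
      forall i, \sum_j p j * P j i = p i].

(* The default value is irrelevant for irreducible chains, which have exactly
   one stationary distribution. *)
Definition stationary_distribution : {ffun V -> R} :=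
  xget [ffun=> 0] [set p | is_stationary p]%classic.

(* Probability that the chain started at j follows X_1 = s_0, X_2 = s_1, ... *)
Fixpoint trajectory_prob (j : V) (s : seq V) : R :=
  if s is y :: s' then P j y * trajectory_prob y s' else 1.

(* Probability that min {m >= 1 | X_m = i} = k when X_0 = j. The tuple x lists
   X_1, ..., X_k, so index 0 is time 1; for i = j this is the return time. *)
Definition first_passage_prob (j i : V) (k : nat) : R :=
  \sum_(x : k.-tuple V | (index i x).+1 == k) trajectory_prob j x.

(* The expectation of the first passage time, assuming it is almost surely
   finite, as is the case for irreducible chains. *)
Definition mean_first_passage (j i : V) : \bar R :=
  (\sum_(0 <= k <oo) (k%:R * first_passage_prob j i k)%:E)%E.

End MarkovChain.

(* The entries of D^-1 A. *)
Definition transition (R : realType) (V : finType) (g : rel V) (x y : V) : R :=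
  (g x y)%:R / (deg g x)%:R.

(* The starting vertex j is kept as a parameter; for a connected graph the value
   does not depend on it. *)
Definition kemeny (R : realType) (V : finType) (g : rel V) (j : V) : \bar R :=
  (\sum_(i : V) (stationary_distribution (@transition R V g) i)%:E *
                mean_first_passage (@transition R V g) j i - 1)%E.

(* Main.v *)
(* Write E(f, k) for the Dirichlet form of g, N(f) for the degree-weighted square
   norm and Q(f) for the square of its distance to the constants.  For a
   complementary subspace W of the constants and an E-orthogonal basis (a) of W,
   the first passage equations give K(g) = sum_a Q(a) / E(a, a).  Let H be g
   without the edge uv and take W = {f | f u + f v = 0}; on it E_H = E - 4 (f u)^2
   and N_H = N - 2 (f u)^2.  Choose bases for G and H adapted to the flag
     {f u = 0} in U := {<f, deg_H> = 0} in W
   and compare termwise.  On {f u = 0} the two Dirichlet forms coincide, so the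
   vectors can be shared, and Q_H = N_H = N >= Q_G.  The vector completing U can
   also be shared, and there Q_H / E_H = (N - 2t) / (E - 4t) >= N / E since
   E <= 2N.  Finally the last vector contributes at least 1/2 for H, again
   because E_H <= 2 Q_H, and at most 2 / phi^2 for G by Cheeger's inequality. *)
Require Import Defs.
From mathcomp Require Import all_boot all_order all_algebra.
From mathcomp Require Import all_classical all_reals all_analysis.
From mathcomp Require Import ring lra zify.

Set Implicit Arguments.
Unset Strict Implicit.
Unset Printing Implicit Defensive.

Import Order.TTheory GRing.Theory Num.Theory.
Import numFieldNormedType.Exports.

Local Open Scope ring_scope.

(** * First passage times by first-step analysis *)

Section FirstPassage.
Variables (R : realType) (V : finType) (P : V -> V -> R).

Lemma first_passage_prob0 j i : first_passage_prob P j i 0 = 0.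
Proof. by rewrite /first_passage_prob big1. Qed.

(** Condition on [X_1]: either it is [i] and the passage takes one step, or the chain restarts at
    [y != i] with [k] steps left. *)
Lemma first_passage_probS j i k :
  first_passage_prob P j i k.+1 =
  (k == 0)%:R * P j i + \sum_(y | y != i) P j y * first_passage_prob P y i k.
Proof.
pose c (p : V * k.-tuple V) : k.+1.-tuple V := [tuple of p.1 :: p.2].
have c_bij : bijective c.
  exists (fun t => (thead t, [tuple of behead t])) => [[y t]|t].
    by rewrite /c /= theadE; congr pair; apply/val_inj.
  by rewrite /c /= -tuple_eta.
rewrite /first_passage_prob (reindex c) /=; last exact: onW_bij.
rewrite -(pair_big_dep xpredT
  (fun y (t : k.-tuple V) => (index i (y :: t)).+1 == k.+1)
  (fun y (t : k.-tuple V) => P j y * trajectory_prob P y t)) /=.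
rewrite (bigD1 i) //= eqxx eqSS; congr (_ + _); last first.
  apply: eq_bigr => y /negPf yi; rewrite yi mulr_sumr.
  by apply: eq_bigl => t; rewrite eqSS.
case: k {c c_bij} => [|k]; last by rewrite mul0r big_pred0.
rewrite mul1r (big_pred1 [tuple]) /=; first by rewrite mulr1.
by move=> t; rewrite tuple0; apply/esym/eqP; rewrite tuple0.
Qed.

Lemma first_passage_prob_ge0 j i k :
  (forall x y, 0 <= P x y) -> 0 <= first_passage_prob P j i k.
Proof.
move=> P0; elim: k j => [|k IH] j; first by rewrite first_passage_prob0.
rewrite first_passage_probS addr_ge0 ?mulr_ge0 ?sumr_ge0 // => y _.
exact: mulr_ge0.
Qed.

(* [h] is only used as a finite upper bound for the partial sums; uniqueness
   of bounded solutions then identifies the limit. *)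
Lemma mean_first_passageE (i : V) (h : V -> R) :
  (forall x y, 0 <= P x y) -> (forall x, \sum_y P x y = 1) ->
  (forall w : V -> R, (forall x, w x = \sum_(y | y != i) P x y * w y) ->
     forall x, w x = 0) ->
  (forall x, 0 <= h x) ->
  (forall x, h x = 1 + \sum_(y | y != i) P x y * h y) ->
  forall j, mean_first_passage P j i = (h j)%:E.
Proof.
move=> P0 P1 P_inj h0 hE j.
pose f x k := first_passage_prob P x i k.
have f0 x k : 0 <= f x k by exact: first_passage_prob_ge0.
(* [F x n] is the probability that the passage time from [x] is below [n], and [M x n] the
   expectation restricted to that event. *)
pose F x n := \sum_(0 <= k < n) f x k.
pose M x n := \sum_(0 <= k < n) k%:R * f x k.
(* The direct step to [i] has passage time 1, so it is counted only once [n.+1] exceeds 1. *)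
have FS x n : F x n.+1 = (0 < n)%:R * P x i + \sum_(y | y != i) P x y * F y n.
  rewrite /F big_nat_recl // {1}/f first_passage_prob0 add0r.
  under eq_bigr do rewrite /f first_passage_probS.
  rewrite big_split /= -mulr_suml; congr (_ * _ + _).
    case: n => [|n]; first by rewrite big_nil.
    by rewrite big_nat_recl //= big1 ?addr0.
  by rewrite exchange_big; apply: eq_bigr => y _; rewrite mulr_sumr.
(* Splitting the weight [k.+1] as [k + 1] separates [F] from the recursion; the direct step is then
   left with weight 0. *)
have MS x n : M x n.+1 = F x n.+1 + \sum_(y | y != i) P x y * M y n.
  rewrite /M /F !big_nat_recl // mul0r {2}/f first_passage_prob0 !add0r.
  under eq_bigr do rewrite -natr1 mulrDl mul1r addrC.
  rewrite big_split /=; congr (_ + _).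
  under eq_bigr do rewrite /f first_passage_probS.
  rewrite (eq_bigr (fun k => \sum_(y | y != i) P x y * (k%:R * f y k))).
    by rewrite exchange_big; apply: eq_bigr => y _; rewrite mulr_sumr.
  move=> [|k] _.
    rewrite mul0r big1 // => y _; by rewrite mul0r mulr0.
  rewrite /= mul0r add0r mulr_sumr; apply: eq_bigr => y _.
  by rewrite mulrCA.
have F_le1 x n : F x n <= 1.
  elim: n x => [|n IH] x; first by rewrite /F big_nil.
  rewrite FS -[leRHS](P1 x) [leRHS](bigD1 i) //= lerD //.
    by case: (0 < n)%N; rewrite /= ?mul1r ?mul0r.
  by apply: ler_sum => y _; rewrite ler_piMr.
have M_leh x n : M x n <= h x.
  elim: n x => [|n IH] x; first by rewrite /M big_nil.
  rewrite MS hE lerD //.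
  by apply: ler_sum => y _; rewrite ler_wpM2l.
have F_nd x : {homo F x : m n / (m <= n)%N >-> m <= n}.
  apply/nondecreasing_seqP => n; rewrite /F big_nat_recr //=.
  by rewrite lerDl.
have M_nd x : {homo M x : m n / (m <= n)%N >-> m <= n}.
  apply/nondecreasing_seqP => n; rewrite /M big_nat_recr //=.
  by rewrite lerDl mulr_ge0.
have F_cv x : cvgn (F x).
  by apply: nondecreasing_is_cvgn => //; exists 1 => _ [n _ <-].
have M_cv x : cvgn (M x).
  by apply: nondecreasing_is_cvgn => //; exists (h x) => _ [n _ <-].
have sum_cv (u : V -> R^nat) (l : V -> R) x :
    (forall y, u y @ \oo --> l y)%classic ->
    ((fun n => \sum_(y | y != i) P x y * u y n) @ \oo -->
      \sum_(y | y != i) P x y * l y)%classic.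
  move=> u_cv.
  apply: cvg_big => [|y _]; first exact: add_continuous.
  by apply: cvgMr; exact: u_cv.
have lim1S (u : R^nat) (l : R) : (u @ \oo --> l)%classic ->
    ((fun n => u n.+1) @ \oo --> l)%classic.
  by move=> u_cv; rewrite (cvg_shiftS u (nbhs l)).
(* The defect [1 - limn (F x)] solves the homogeneous equation killed at [i], so it vanishes:
   passage is almost surely finite. The double index shift gets past the factor [(0 < n)%:R]. *)
have limF x : limn (F x) = 1.
  suff /(_ x) : forall x, 1 - limn (F x) = 0 by move/eqP; rewrite subr_eq0 => /eqP.
  apply: P_inj => {}x.
  have -> : limn (F x) = P x i + \sum_(y | y != i) P x y * limn (F y).
    apply: (cvg_unique _ (lim1S _ _ (lim1S _ _ (F_cv x)))) => //=.
    have -> : (fun n => F x n.+2) =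
        (fun n => P x i + \sum_(y | y != i) P x y * F y n.+1).
      by apply/funext => n; rewrite FS mul1r.
    apply: cvgD; first exact: cvg_cst.
    by apply: sum_cv => y; exact: lim1S.
  under [RHS]eq_bigr do rewrite mulrBr mulr1.
  rewrite sumrB -{1}(P1 x) (bigD1 i) //=; ring.
(* By [limF] the source term tends to the 1 in the equation of [h], so the difference is again a
   homogeneous solution. *)
have limM x : limn (M x) = h x.
  suff /(_ x) : forall x, h x - limn (M x) = 0.
    by move/eqP; rewrite subr_eq0 => /eqP.
  apply: P_inj => {}x.
  have -> : limn (M x) = 1 + \sum_(y | y != i) P x y * limn (M y).
    apply: (cvg_unique _ (lim1S _ _ (M_cv x))) => //=.
    have -> : (fun n => M x n.+1) =
        (fun n => F x n.+1 + \sum_(y | y != i) P x y * M y n).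
      by apply/funext => n; rewrite MS.
    apply: cvgD; last exact: sum_cv.
    by rewrite -(limF x); exact: lim1S.
  under [RHS]eq_bigr do rewrite mulrBr.
  rewrite sumrB {1}hE; ring.
rewrite /mean_first_passage -(limM j) -EFin_lim //.
by congr (limn _); apply/funext => n; rewrite /= /M sumEFin.
Qed.

End FirstPassage.

(** * Dirichlet form, weighted variance and orthogonal expansions *)

Section Energy.
Variables (R : realType) (V : finType).
Implicit Types (g : rel V) (f h k : V -> R) (U W : (V -> R) -> Prop).

Definition lap g f x : R := \sum_y (g x y)%:R * (f x - f y).

(** The Dirichlet form; for symmetric [g] the half undoes the double count of each edge. *)
Definition energy g f h : R :=
  2^-1 * \sum_x \sum_y (g x y)%:R * (f x - f y) * (h x - h y).

Definition dsum g f : R := \sum_x (deg g x)%:R * f x.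

Definition dnorm g f : R := \sum_x (deg g x)%:R * f x ^+ 2.

Definition total_deg g : R := \sum_x (deg g x)%:R.

(* The squared distance from [f] to the constants in the degree-weighted
   norm. *)
Definition dvar g f : R := dnorm g f - dsum g f ^+ 2 / total_deg g.

Lemma degE g x : (deg g x)%:R = \sum_y (g x y)%:R :> R.
Proof.
rewrite /deg -sum1_card natr_sum big_mkcond /=.
by apply: eq_bigr => y _; rewrite inE; case: (g x y).
Qed.

Lemma energyC g f h : energy g f h = energy g h f.
Proof.
rewrite /energy; congr (_ * _); apply: eq_bigr => x _.
by apply: eq_bigr => y _; rewrite mulrAC.
Qed.

Lemma energy_linl g c f h k :
  energy g (fun x => c * f x + h x) k = c * energy g f k + energy g h k.
Proof.
rewrite /energy mulrCA -mulrDr [c * _]mulr_sumr -big_split /=; congr (_ * _).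
apply: eq_bigr => x _; rewrite mulr_sumr -big_split /=.
by apply: eq_bigr => y _; ring.
Qed.

Lemma energy_shiftr g c f h : energy g f (fun x => h x - c) = energy g f h.
Proof.
rewrite /energy; congr (_ * _); apply: eq_bigr => x _.
by apply: eq_bigr => y _; congr (_ * _); ring.
Qed.

Lemma energy_shiftl g c f h : energy g (fun x => f x - c) h = energy g f h.
Proof. by rewrite energyC energy_shiftr energyC. Qed.

Lemma energy0l g h : energy g (fun=> 0) h = 0.
Proof.
rewrite /energy big1 ?mulr0 // => x _.
by rewrite big1 // => y _; rewrite subrr mulr0 mul0r.
Qed.

Lemma energy_suml g (s : seq (V -> R)) (c : (V -> R) -> R) h :
  energy g (fun x => \sum_(a <- s) c a * a x) h =
  \sum_(a <- s) c a * energy g a h.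
Proof.
elim: s => [|a s IH].
  by under eq_fun do rewrite big_nil; rewrite big_nil energy0l.
by under eq_fun do rewrite big_cons; rewrite big_cons -IH -energy_linl.
Qed.

Lemma energy_lap g f h : symmetric g -> energy g f h = \sum_x f x * lap g h x.
Proof.
move=> g_sym; rewrite /energy.
have -> : \sum_x \sum_y (g x y)%:R * (f x - f y) * (h x - h y) =
    \sum_x \sum_y (g x y)%:R * f x * (h x - h y) +
    \sum_x \sum_y (g x y)%:R * f y * (h y - h x).
  rewrite -big_split; apply: eq_bigr => x _; rewrite -big_split.
  by apply: eq_bigr => y _ /=; ring.
rewrite [X in _ + X]exchange_big /=.
under [X in _ + X]eq_bigr do under eq_bigr do rewrite g_sym.
have half2 (a : R) : 2^-1 * (a + a) = a by field.
rewrite half2.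
apply: eq_bigr => x _; rewrite /lap mulr_sumr.
by apply: eq_bigr => y _; rewrite mulrCA mulrA.
Qed.

Lemma energy_ge0 g f : 0 <= energy g f f.
Proof.
rewrite mulr_ge0 ?invr_ge0 ?ler0n // sumr_ge0 // => x _; rewrite sumr_ge0 // => y _.
by rewrite -mulrA mulr_ge0 ?ler0n // -expr2 sqr_ge0.
Qed.

(** Every summand is nonnegative, so zero energy makes [f] agree across each edge and then along
    paths. *)
Lemma energy_eq0 g f : connected_graph g -> energy g f f = 0 ->
  forall x y, f x = f y.
Proof.
move=> g_conn E0.
have fE x y : g x y -> f x = f y.
  move=> gxy; move/eqP: E0; rewrite mulf_eq0 invr_eq0 pnatr_eq0 /=.
  have term0 a b : 0 <= (g a b)%:R * (f a - f b) * (f a - f b).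
    by rewrite -mulrA mulr_ge0 ?ler0n // -expr2 sqr_ge0.
  rewrite psumr_eq0 => [|a _]; last exact: sumr_ge0.
  move=> /allP /(_ x (mem_index_enum x)) /=.
  rewrite psumr_eq0 => [|b _]; last exact: term0.
  move=> /allP /(_ y (mem_index_enum y)) /=.
  by rewrite gxy mul1r -expr2 sqrf_eq0 subr_eq0 => /eqP.
move=> x y; have /connectP[p] := g_conn x y.
by elim: p x => [|z p IH] x /= => [_ ->//|/andP[/fE -> /IH]].
Qed.

Lemma dnorm_shift g c f :
  dnorm g (fun x => f x - c) = dnorm g f - c *+ 2 * dsum g f + c ^+ 2 * total_deg g.
Proof.
rewrite /dnorm /dsum /total_deg !mulr_sumr -sumrN -!big_split /=.
by apply: eq_bigr => x _; ring.
Qed.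

(** Completing the square in [c]; the minimum is at the weighted mean of [f]. *)
Lemma dvar_le_dnorm g c f : 0 < total_deg g ->
  dvar g f <= dnorm g (fun x => f x - c).
Proof.
move=> T0; rewrite dnorm_shift /dvar -subr_ge0.
have -> : dnorm g f - c *+ 2 * dsum g f + c ^+ 2 * total_deg g -
    (dnorm g f - dsum g f ^+ 2 / total_deg g) =
    (dsum g f - c * total_deg g) ^+ 2 / total_deg g by field; rewrite gt_eqF.
by rewrite divr_ge0 ?sqr_ge0 ?ltW.
Qed.

Lemma dvarE g f : 0 < total_deg g ->
  dvar g f = dnorm g (fun x => f x - dsum g f / total_deg g).
Proof. by move=> T0; rewrite dnorm_shift /dvar; field; rewrite gt_eqF. Qed.

Lemma dnormE g f : symmetric g ->
  dnorm g f = 2^-1 * \sum_x \sum_y (g x y)%:R * (f x ^+ 2 + f y ^+ 2).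
Proof.
move=> g_sym; have -> : \sum_x \sum_y (g x y)%:R * (f x ^+ 2 + f y ^+ 2) =
    dnorm g f + dnorm g f.
  transitivity (\sum_x \sum_y (g x y)%:R * f x ^+ 2 +
                \sum_x \sum_y (g x y)%:R * f y ^+ 2).
    rewrite -big_split; apply: eq_bigr => x _; rewrite -big_split.
    by apply: eq_bigr => y _ /=; rewrite mulrDr.
  rewrite [X in _ + X]exchange_big /=.
  under [X in _ + X]eq_bigr do under eq_bigr do rewrite g_sym.
  by congr (_ + _); apply: eq_bigr => x _; rewrite -mulr_suml -degE.
by field.
Qed.

(** Edge by edge, [2 * (a ^+ 2 + b ^+ 2) - (a - b) ^+ 2] is the square of [a + b]. This is the bound
    2 on the spectrum of the normalized Laplacian. *)
Lemma energy_le_dnorm g f : symmetric g -> energy g f f <= 2 * dnorm g f.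
Proof.
move=> g_sym; rewrite (dnormE _ g_sym) mulrCA.
rewrite ler_wpM2l ?invr_ge0 ?ler0n // mulr_sumr ler_sum // => x _.
rewrite mulr_sumr ler_sum // => y _.
case: (g x y); last by rewrite !mul0r mulr0.
rewrite !mul1r -subr_ge0; have := sqr_ge0 (f x + f y); congr (_ <= _); ring.
Qed.

Lemma energy_le_dvar g f : symmetric g -> 0 < total_deg g ->
  energy g f f <= 2 * dvar g f.
Proof.
move=> g_sym T0; rewrite dvarE //.
rewrite -(energy_shiftl _ (dsum g f / total_deg g))
  -(energy_shiftr _ (dsum g f / total_deg g)).
exact: energy_le_dnorm.
Qed.

Lemma connected_deg_gt0 g x : (2 <= #|V|)%N -> connected_graph g ->
  (0 < deg g x)%N.
Proof.
move=> V2 g_conn.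
have /card_gt0P[y] : (0 < #|predC1 x|)%N by rewrite cardC1; case: #|V| V2 => [|[]].
rewrite inE /= => yx; have /connectP[[|z p] /=] := g_conn x y.
  by move=> _ yE; rewrite yE eqxx in yx.
by case/andP=> gxz _ _; apply/card_gt0P; exists z; rewrite inE.
Qed.

Lemma total_deg_gt0 g : (2 <= #|V|)%N -> connected_graph g -> 0 < total_deg g.
Proof.
move=> V2 g_conn; have /card_gt0P[x _] : (0 < #|V|)%N by exact: ltn_trans V2.
rewrite /total_deg (bigD1 x) //= ltr_pwDl ?ltr0n ?connected_deg_gt0 //.
by rewrite sumr_ge0 // => y _; rewrite ler0n.
Qed.

Definition linear_subspace U :=
  U (fun=> 0) /\ forall c f h, U f -> U h -> U (fun x => c * f x + h x).

Lemma subspace_sum U (s : seq (V -> R)) (c : (V -> R) -> R) :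
  linear_subspace U -> {in s, forall a, U a} -> U (fun x => \sum_(a <- s) c a * a x).
Proof.
move=> [U0 UD]; elim: s => [|a s IH] sU.
  by under eq_fun do rewrite big_nil.
under eq_fun do rewrite big_cons.
apply: UD; first by apply: sU; rewrite mem_head.
by apply: IH => b bs; apply: sU; rewrite inE bs orbT.
Qed.

(** For a connected graph this means that [U] contains no nonzero constant. *)
Definition definite_on g U :=
  forall f, U f -> energy g f f = 0 -> forall x, f x = 0.

(* Satisfied by the [energy g]-orthogonal bases of [U], possibly padded with
   zero vectors, whose coefficient is [_ / 0 = 0]. *)
Definition expands g U (s : seq (V -> R)) :=
  {in s, forall a, U a} /\
  forall f, U f ->
    forall x, f x = \sum_(a <- s) energy g f a / energy g a a * a x.

Lemma subspace_ker U (t : (V -> R) -> R) :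
  linear_subspace U -> (forall c f h, t (fun x => c * f x + h x) = c * t f + t h) ->
  linear_subspace (fun f => U f /\ t f = 0).
Proof.
move=> [U0 UD] t_lin; split.
  split=> //; transitivity (-1 * t (fun=> 0) + t (fun=> 0)); last by ring.
  by rewrite -t_lin; congr t; apply/funext => x; rewrite mulr0 addr0.
by move=> c f h [Uf tf] [Uh th]; split; [exact: UD|rewrite t_lin tf th mulr0 addr0].
Qed.

(** A Gram-Schmidt step: [b] is energy-orthogonal to the kernel of [t] in [U] and spans [U] together
    with it; it is zero when [t] vanishes on [U]. *)
Lemma expands_normal g U s (t : (V -> R) -> R) :
  linear_subspace U -> (forall c f h, t (fun x => c * f x + h x) = c * t f + t h) ->
  expands g (fun f => U f /\ t f = 0) s ->
  exists b, [/\ U b,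
    (forall f, U f -> exists c, U (fun x => c * b x + f x) /\
                                t (fun x => c * b x + f x) = 0) &
    forall f, U f -> t f = 0 -> energy g b f = 0].
Proof.
move=> U_sub t_lin [sU0 sE]; have [Uz UD] := U_sub.
have [t0|] := pselect (forall f, U f -> t f = 0).
  exists (fun=> 0); split=> // f; last by rewrite energy0l.
  move=> Uf; exists 0; split; first exact: UD.
  by rewrite t_lin mul0r add0r t0.
move=> /existsNP[f0 /not_implyP[Uf0 /eqP tf0]].
(* [p] is the energy projection of [f0] onto the kernel of [t], so [f0 - p] is normal to it. *)
pose p x := \sum_(a <- s) energy g f0 a / energy g a a * a x.
have [Up tp] : U p /\ t p = 0.
  exact: (@subspace_sum (fun f => U f /\ t f = 0) s _ (subspace_ker U_sub t_lin) sU0).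
exists (fun x => -1 * p x + f0 x); split; first exact: UD.
  move=> f Uf; exists (- (t f / t f0)); split; first by apply: (UD) => //; apply: UD.
  by rewrite !t_lin tp; field.
(* Expanding [f] as well turns its pairings with [p] and with [f0] into the same sum. *)
move=> f Uf tf; rewrite energy_linl energy_suml.
have {2}-> : f = (fun x => \sum_(a <- s) energy g f a / energy g a a * a x).
  by apply/funext; exact: sE.
rewrite (energyC g f0) energy_suml mulN1r addrC -sumrB big1 // => a _.
by rewrite (energyC g a f) (energyC g a f0); ring.
Qed.

(** Write [f] as [f1 - c * b] with [f1] in the kernel of [t]: by orthogonality the coefficients
    along [s] see only [f1], and the one along [b] is [- c]. *)
Lemma expands_cons g U s b (t : (V -> R) -> R) :
  definite_on g U -> expands g (fun f => U f /\ t f = 0) s -> U b ->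
  (forall f, U f -> exists c, U (fun x => c * b x + f x) /\
                              t (fun x => c * b x + f x) = 0) ->
  (forall f, U f -> t f = 0 -> energy g b f = 0) ->
  expands g U (b :: s).
Proof.
move=> U_def [sU0 sE] Ub b_codim b_orth; split.
  by move=> a; rewrite inE => /predU1P[->//|/sU0[]].
move=> f Uf x; rewrite big_cons; have [c [Uf1 tf1]] := b_codim f Uf.
set f1 := (fun x => _) in Uf1 tf1.
have Ef1 k : energy g f k = energy g f1 k - c * energy g b k.
  by rewrite energy_linl; ring.
have -> : \sum_(a <- s) energy g f a / energy g a a * a x = f1 x.
  rewrite sE //; apply: eq_big_seq => a /sU0[Ua ta].
  by rewrite Ef1 b_orth // mulr0 subr0.
rewrite Ef1 (energyC g f1) b_orth // sub0r /f1.
(* If [b] has zero energy, definiteness makes it the zero vector and its term vanishes. *)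
have [Eb0|Eb_neq0] := eqVneq (energy g b b) 0.
  by rewrite (U_def b Ub Eb0); ring.
by field.
Qed.

(** Gram-Schmidt along a flag: functions vanishing at every vertex have the empty expansion;
    vertices are then released one at a time, with evaluation there as the functional [t]. *)
Lemma expands_exists g U : linear_subspace U -> definite_on g U ->
  exists s, expands g U s.
Proof.
suff H (l : seq V) : forall W, linear_subspace W -> definite_on g W ->
    (exists s, expands g (fun f => W f /\ forall x, x \in l -> f x = 0) s) ->
    exists s, expands g W s.
  move=> U_sub U_def; apply: (H (enum V)) => //; exists [::]; split=> //.
  by move=> f [_ f0] x; rewrite big_nil f0 ?mem_enum.
elim: l => [|z l IH] W W_sub W_def [s sE].
  by exists s; congr (expands _ _ _): sE;
    apply/funext => f; apply/propext; split => [[]|].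
pose W0 f := W f /\ f z = 0.
have ev_lin c f h : c * f z + h z = c * f z + h z by [].
have [s0 s0E] : exists s0, expands g W0 s0.
  apply: IH => //.
  - exact: (@subspace_ker W (fun f => f z)).
  - by move=> f [Wf _]; exact: W_def.
  exists s; congr (expands _ _ _): sE; apply/funext => f; apply/propext; split.
    move=> [Wf f0]; split; first by split=> //; apply: f0; rewrite mem_head.
    by move=> x xl; apply: f0; rewrite inE xl orbT.
  by move=> [[Wf fz] f0]; split=> // x; rewrite inE => /predU1P[->//|/f0].
have [b [Wb b_codim b_orth]] := expands_normal W_sub ev_lin s0E.
by exists (b :: s0); exact: (@expands_cons g W s0 b (fun f => f z)).
Qed.

End Energy.

(** * Kemeny's constant as a sum over an orthogonal expansion *)

Section Kemeny.
Variables (R : realType) (V : finType) (g : rel V).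
Hypotheses (g_sym : symmetric g) (V_ge2 : (2 <= #|V|)%N)
  (g_conn : connected_graph g).

Let P := @transition R V g.

Let deg_neq0 x : (deg g x)%:R != 0 :> R.
Proof. by rewrite pnatr_eq0 -lt0n connected_deg_gt0. Qed.

Lemma transition_ge0 x y : 0 <= P x y.
Proof. by rewrite /P /transition divr_ge0 ?ler0n. Qed.

Lemma transition_sum1 x : \sum_y P x y = 1.
Proof. by rewrite /P /transition -mulr_suml -degE divff. Qed.

Lemma lapE (f : V -> R) x :
  lap g f x = (deg g x)%:R * (f x - \sum_y P x y * f y).
Proof.
rewrite mulrBr mulr_sumr {1}degE mulr_suml -sumrB; apply: eq_bigr => y _.
by rewrite /P /transition; field.
Qed.

(** For uniqueness, a stationary [p] divided by the degrees is harmonic, so it has zero energy and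
    is constant; total mass 1 fixes the constant. *)
Lemma stationary_distributionE i :
  stationary_distribution P i = (deg g i)%:R / total_deg R g.
Proof.
have T0 : 0 < total_deg R g by exact: total_deg_gt0.
suff -> : stationary_distribution P = [ffun x => (deg g x)%:R / total_deg R g].
  by rewrite ffunE.
apply: xget_unique => [|p [p0 p1 pP]].
  split=> [x||x]; first by rewrite ffunE divr_ge0 ?ler0n // ltW.
    by under eq_bigr do rewrite ffunE; rewrite -mulr_suml divff ?gt_eqF.
  under eq_bigr do rewrite ffunE /P /transition.
  rewrite ffunE degE mulr_suml; apply: eq_bigr => y _.
  by rewrite [g x y]g_sym; field; rewrite deg_neq0 gt_eqF.
pose q x := p x / (deg g x)%:R.
have qE : energy g q q = 0.
  rewrite energy_lap // big1 // => x _.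
  suff -> : lap g q x = 0 by rewrite mulr0.
  rewrite lapE /q mulrBr mulrC divfK // -[X in X - _]pP mulr_sumr -sumrB big1 // => y _.
  rewrite /P /transition [g y x]g_sym; field.
  by rewrite !deg_neq0.
have q_const x : p x = q i * (deg g x)%:R.
  by rewrite (energy_eq0 g_conn qE i x) divfK.
have qi : q i = (total_deg R g)^-1.
  apply: (mulIf (lt0r_neq0 T0)); rewrite mulVf ?gt_eqF // -p1 mulr_sumr.
  by apply: eq_bigr => x _; rewrite q_const.
by apply/ffunP => x; rewrite ffunE q_const qi mulrC.
Qed.

(** Supplies the uniqueness hypothesis of [mean_first_passageE]. The Laplacian of [w0] vanishes off
    [i] and [w0] vanishes at [i], so [w0] has zero energy and is constant. *)
Lemma killed_harmonic_eq0 i (w : V -> R) :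
  (forall x, w x = \sum_(y | y != i) P x y * w y) -> forall x, w x = 0.
Proof.
move=> w_harm; pose w0 x := if x == i then 0 else w x.
have wE x : w x = \sum_y P x y * w0 y.
  rewrite w_harm [RHS](bigD1 i) //= [w0 i]/w0 eqxx mulr0 add0r.
  by apply: eq_bigr => y /negPf yi; rewrite /w0 yi.
have w0E : energy g w0 w0 = 0.
  rewrite energy_lap // big1 // => x _; rewrite lapE -wE {1 2}/w0.
  by case: eqP => _; rewrite ?mul0r // subrr !mulr0.
move=> x; rewrite wE big1 // => y _.
by rewrite (energy_eq0 g_conn w0E y i) /w0 eqxx mulr0.
Qed.

(* The hitting time [h i] of [i] solves [lap (h i) = deg - total_deg * 1_i],
   that is, [energy (h i) f = dsum f - total_deg * f i] for all [f]; the
   expansion provides such an [h i] explicitly. *)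
Lemma kemenyE (W : (V -> R) -> Prop) (s : seq (V -> R)) j :
  (forall f, exists c, W (fun x => f x - c)) -> expands g W s ->
  kemeny R g j = (\sum_(a <- s) dvar g a / energy g a a)%:E.
Proof.
move=> W_shift [_ sE]; have T0 : 0 < total_deg R g by exact: total_deg_gt0.
have T_neq0 : total_deg R g != 0 by rewrite gt_eqF.
pose l i (f : V -> R) := dsum g f - total_deg R g * f i.
have l_shift i c f : l i (fun x => f x - c) = l i f.
  rewrite /l /dsum; under eq_bigr do rewrite mulrBr.
  by rewrite sumrB -mulr_suml -/(total_deg R g); ring.
have l_sum i (c : (V -> R) -> R) :
    l i (fun x => \sum_(a <- s) c a * a x) = \sum_(a <- s) c a * l i a.
  rewrite /l /dsum mulr_sumr.
  under eq_bigr do rewrite mulr_sumr.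
  rewrite exchange_big -sumrB; apply: eq_bigr => a _ /=.
  rewrite mulrBr mulr_sumr mulrCA; congr (_ - _); apply: eq_bigr => x _.
  by rewrite mulrCA.
(* [h i] represents the functional [l i] for the energy form, read off from the expansion; the
   second sum makes it vanish at [i]. *)
pose h i x := \sum_(a <- s) l i a / energy g a a * a x
              - \sum_(a <- s) l i a / energy g a a * a i.
have hE i f : energy g (h i) f = l i f.
  have [c Wf] := W_shift f; rewrite -(energy_shiftr g c) -(l_shift i c).
  set f1 := fun x => f x - c; rewrite /h energy_shiftl energy_suml.
  have f1E : f1 = (fun x => \sum_(a <- s) energy g f1 a / energy g a a * a x).
    by apply/funext; exact: sE.
  rewrite [in RHS]f1E l_sum; apply: eq_bigr => a _.
  by rewrite (energyC g a); ring.
have lap_h i x : lap g (h i) x = (deg g x)%:R - total_deg R g * (x == i)%:R.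
  have := hE i (fun y => (y == x)%:R); rewrite energyC energy_lap //.
  rewrite (bigD1 x) //= eqxx mul1r big1 ?addr0 => [->|y /negPf ->]; last by rewrite mul0r.
  rewrite /l /dsum (bigD1 x) //= eqxx mulr1 big1 ?addr0 => [|y /negPf ->].
    by rewrite eq_sym.
  by rewrite mulr0.
have hii i : h i i = 0 by rewrite /h subrr.
(* Minimum principle: at a minimizer [m] other than [i] the Laplacian would be at most 0, yet it
   equals the positive degree of [m]. *)
have h_ge0 i x : 0 <= h i x.
  have [m _ m_min] := Order.TotalTheory.arg_minP (P := xpredT) (h i) (erefl : xpredT i).
  suff mi : m = i by have := m_min x erefl; rewrite mi hii.
  apply/eqP; apply: contraT => /negPf mi.
  have := lap_h i m; rewrite mi mulr0 subr0 => lap_m.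
  have : lap g (h i) m <= 0.
    rewrite /lap sumr_le0 // => y _.
    by rewrite mulr_ge0_le0 ?ler0n // subr_le0; exact: m_min.
  by rewrite lap_m lern0 -leqn0 leqNgt connected_deg_gt0.
(* Started at [i], the chain needs its mean return time, whereas [h i] is 0 there. *)
pose m i x := if x == i then total_deg R g / (deg g i)%:R else h i x.
have mE i x : mean_first_passage P x i = (m i x)%:E.
  apply: mean_first_passageE => {x}.
  - exact: transition_ge0.
  - exact: transition_sum1.
  - exact: killed_harmonic_eq0.
  - by move=> x; rewrite /m; case: eqP => // _; rewrite divr_ge0 ?ler0n // ltW.
  move=> x; have -> : \sum_(y | y != i) P x y * m i y = \sum_y P x y * h i y.
    rewrite [RHS](bigD1 i) //= hii mulr0 add0r.
    by apply: eq_bigr => y /negPf yi; rewrite /m yi.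
  have hx : \sum_y P x y * h i y =
      h i x - ((deg g x)%:R - total_deg R g * (x == i)%:R) / (deg g x)%:R.
    by rewrite -lap_h lapE; field.
  rewrite hx /m; have [->|_] := eqVneq x i; last by rewrite mulr0 subr0 divff //; ring.
  by rewrite hii /=; field.
rewrite /kemeny.
under eq_bigr do rewrite -/P stationary_distributionE mE -EFinM.
rewrite sumEFin -EFinB; congr EFin.
(* The term [i = j] equals 1 and cancels the [- 1] in [kemeny]. *)
rewrite (bigD1 j) //= /m eqxx mulrA divfK // divff // addrC addrK.
rewrite (eq_bigr (fun i => (deg g i)%:R / total_deg R g * h i j)); last first.
  by move=> i /negPf; rewrite eq_sym => ->.
transitivity (\sum_i (deg g i)%:R / total_deg R g * h i j).
  by rewrite [RHS](bigD1 j) //= hii mulr0 add0r.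
rewrite /h; under [LHS]eq_bigr do rewrite -sumrB mulr_sumr.
rewrite exchange_big /=; apply: eq_bigr => a _.
move: (energy g a a)^-1 => e.
(* The terms in [a j] cancel, which removes the dependence on the starting vertex. *)
transitivity (e / total_deg R g * (dsum g a * a j * total_deg R g -
    (dsum g a + total_deg R g * a j) * dsum g a + total_deg R g * dnorm g a)).
  rewrite {3}/total_deg {3}/dsum /dnorm !mulr_sumr -sumrB -big_split /= mulr_sumr.
  by apply: eq_bigr => i _; rewrite /l; field.
by rewrite /dvar; field.
Qed.

End Kemeny.

(** * Cheeger's inequality *)

Section Cheeger.
Variables (R : realType) (V : finType) (g : rel V).
Hypotheses (g_sym : symmetric g) (V_ge2 : (2 <= #|V|)%N)
  (g_conn : connected_graph g).

Implicit Types (f : V -> R) (S : {set V}).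

Let phi := conductance R g.

Lemma cutE S :
  (Defs.cut g S)%:R = energy g (fun x => (x \in S)%:R) (fun x => (x \in S)%:R) :> R.
Proof.
have -> : (Defs.cut g S)%:R =
    \sum_x \sum_y (g x y)%:R * (x \in S)%:R * (y \notin S)%:R :> R.
  rewrite /Defs.cut -sum1_card natr_sum big_mkcond pair_big /=.
  apply: eq_bigr => -[x y] _; rewrite inE /=.
  by case: (x \in S); case: (y \in S); case: (g x y); rewrite /= ?(mulr0, mul0r, mulr1).
rewrite /energy; set c := (LHS).
have cC : c = \sum_x \sum_y (g x y)%:R * (x \notin S)%:R * (y \in S)%:R.
  rewrite /c exchange_big; apply: eq_bigr => x _; apply: eq_bigr => y _ /=.
  by rewrite g_sym mulrAC.
have -> : \sum_x \sum_y (g x y)%:R * ((x \in S)%:R - (y \in S)%:R) *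
    ((x \in S)%:R - (y \in S)%:R) = c + c.
  rewrite [X in _ = _ + X]cC -big_split; apply: eq_bigr => x _ /=.
  rewrite -big_split; apply: eq_bigr => y _ /=.
  by case: (x \in S); case: (y \in S); rewrite /=; ring.
by field.
Qed.

Lemma volE S : (vol g S)%:R = \sum_(x in S) (deg g x)%:R :> R.
Proof. exact: natr_sum. Qed.

Lemma volC S : (vol g S + vol g (~: S) = vol g finset.setT)%N.
Proof.
rewrite /vol [RHS](bigID (mem S)) /=; congr (_ + _)%N; apply: eq_bigl => x.
  by rewrite inE.
by rewrite !inE.
Qed.

Lemma vol_gt0 S : S != finset.set0 -> (0 < vol g S)%N.
Proof.
case/finset.set0Pn=> x xS; rewrite /vol (bigD1 x) //= addn_gt0.
by rewrite connected_deg_gt0.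
Qed.

Lemma cut_ratio_ge0 S : 0 <= cut_ratio R g S.
Proof. by rewrite divr_ge0 ?ler0n. Qed.

Lemma conductance_le S : S != finset.set0 -> S != finset.setT -> phi <= cut_ratio R g S.
Proof.
move=> S0 ST; apply: ge_inf; last by exists S.
by exists 0 => _ [S' _ <-]; exact: cut_ratio_ge0.
Qed.

Lemma cut_gt0 S : S != finset.set0 -> S != finset.setT -> (0 < Defs.cut g S)%N.
Proof.
case/finset.set0Pn=> x xS ST; have [y yS] : exists y, y \notin S.
  apply/existsP; apply: contraNT ST; rewrite negb_exists => /forallP H.
  by apply/eqP/setP => y; rewrite inE; have := H y; rewrite negbK.
rewrite lt0n -(pnatr_eq0 R) cutE; apply/eqP => E0.
have := energy_eq0 g_conn E0 x y; rewrite xS (negPf yS) => /eqP.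
by rewrite oner_eq0.
Qed.

(** By connectedness every nontrivial cut has at least one edge, and no denominator exceeds the
    total volume. *)
Lemma conductance_gt0 : 0 < phi.
Proof.
have volT : (0 < vol g finset.setT)%N.
  rewrite vol_gt0 // -cards_eq0 cardsT; by case: #|V| V_ge2.
apply: (@lt_le_trans _ _ ((vol g finset.setT)%:R)^-1); first by rewrite invr_gt0 ltr0n.
apply: lb_le_inf.
  have /card_gt0P[x _] : (0 < #|V|)%N by exact: ltn_trans V_ge2.
  exists (cut_ratio R g [set x]), [set x] => //; split.
    by apply/finset.set0Pn; exists x; rewrite inE.
  by rewrite eqEcard negb_and finset.subsetT -ltnNge cardsT cards1 V_ge2.
move=> _ [S [S0 ST] <-]; rewrite /cut_ratio.
have cS := cut_gt0 S0 ST; have vS := vol_gt0 S0.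
have vC : (0 < vol g (~: S))%N
  by apply: vol_gt0; rewrite -finset.setCT (inj_eq (@finset.setC_inj V)).
have m0 : (0 < minn (vol g S) (vol g (~: S)))%N by rewrite leq_min vS.
rewrite -[X in X <= _]mul1r ler_pM ?invr_ge0 ?ler0n ?ler1n //.
rewrite lef_pV2 ?posrE ?ltr0n // ler_nat geq_min -(volC S) leq_addr //.
Qed.

Lemma conductance_cut S : ((vol g S).*2 <= vol g finset.setT)%N ->
  phi * (vol g S)%:R <= (Defs.cut g S)%:R.
Proof.
move=> volS; have [->|S0] := eqVneq S finset.set0.
  by rewrite volE big_set0 mulr0.
have vS := vol_gt0 S0.
have ST : S != finset.setT.
  by apply: contraTneq volS => ST;
    rewrite -ltnNge -ST -addnn -{1}[vol g S]addn0 ltn_add2l.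
have := conductance_le S0 ST; rewrite /cut_ratio (minn_idPl _); last first.
  by rewrite -(leq_add2l (vol g S)) volC addnn.
by rewrite ler_pdivlMr ?ltr0n.
Qed.

(** Peel off layers: subtracting the least positive value [a] on the support [S] lowers the left
    side by [phi * a * vol g S] and the right side by [a * cut g S]. These compare by
    [conductance_cut], and the support shrinks. *)
Lemma coarea f : (forall x, 0 <= f x) ->
  ((vol g [set x | (0 < f x)%R]).*2 <= vol g finset.setT)%N ->
  phi * dsum g f <= 2^-1 * \sum_x \sum_y (g x y)%:R * `|f x - f y|.
Proof.
have [n] := ubnP #|[set x | (0 < f x)%R]|; elim: n f => // n IH f.
set S := [set x | (0 < f x)%R] => Sn f0 volS.
have fN x : x \notin S -> f x = 0.
  by rewrite inE -leNgt => fx; apply/eqP; rewrite eq_le fx f0.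
have [S0|/finset.set0Pn[z zS]] := eqVneq S finset.set0.
  rewrite /dsum big1 ?mulr0 => [|x _]; last by rewrite fN ?S0 ?inE // mulr0.
  rewrite mulr_ge0 ?invr_ge0 ?ler0n // sumr_ge0 // => x _.
  by rewrite sumr_ge0 // => y _; rewrite mulr_ge0.
have [m mS m_min] := Order.TotalTheory.arg_minP (P := mem S) f zS.
have {}mS : m \in S := mS.
pose a := f m; have a0 : 0 < a by move: mS; rewrite inE.
pose f1 x := f x - a * (x \in S)%:R.
have f1_ge0 x : 0 <= f1 x.
  rewrite /f1; have [xS|/fN ->] := boolP (x \in S); last by rewrite mulr0 subr0.
  by rewrite mulr1 subr_ge0; exact: m_min.
have sub1 : [set x | (0 < f1 x)%R] \proper S.
  apply/properP; split; last by exists m => //; rewrite inE /f1 mS mulr1 subrr ltxx.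
  apply/fintype.subsetP => x; rewrite inE; apply: contraTT => xS.
  by rewrite /f1 fN // (negPf xS) mulr0 subr0 ltxx.
have vol1 : (vol g [set x | (0 < f1 x)%R] <= vol g S)%N.
  rewrite /vol [leqRHS](big_setID [set x | (0 < f1 x)%R]) /=.
  by rewrite (finset.setIidPr (proper_sub sub1)) leq_addr.
have := IH f1 (leq_trans (proper_card sub1) Sn) f1_ge0
  (leq_trans (_ : _ <= _)%N volS).
rewrite leq_double vol1 => /(_ isT) {}IH.
have -> : dsum g f = dsum g f1 + a * (vol g S)%:R.
  rewrite volE big_mkcond /= mulr_sumr /dsum -big_split /=; apply: eq_bigr => x _.
  by rewrite /f1; case: (x \in S) => /=; ring.
(* Only edges leaving [S] change their difference, by exactly [a]. *)
have -> : 2^-1 * \sum_x \sum_y (g x y)%:R * `|f x - f y| =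
    2^-1 * \sum_x \sum_y (g x y)%:R * `|f1 x - f1 y| + a * (Defs.cut g S)%:R.
  rewrite cutE /energy mulrCA -mulrDr [a * _]mulr_sumr -big_split; congr (_ * _).
  apply: eq_bigr => x _ /=; rewrite mulr_sumr -big_split; apply: eq_bigr => y _ /=.
  rewrite -mulrA mulrCA -mulrDr; congr (_ * _).
  have := f1_ge0 x; have := f1_ge0 y; rewrite /f1.
  have [xS|/fN ->] := boolP (x \in S); have [yS|/fN ->] := boolP (y \in S).
  - by move=> _ _; rewrite subrr !mulr0 addr0; congr `|_|; ring.
  - rewrite mulr0 !subr0 !mulr1 => _ fx.
    by rewrite (ger0_norm fx) ger0_norm ?f0 //; ring.
  - rewrite /= mulr0 !subr0 !sub0r !mulr1 => fy _.
    by rewrite !normrN (ger0_norm fy) ger0_norm ?f0 //; ring.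
  - by move=> _ _; rewrite !subrr normr0 !mulr0 addr0.
rewrite mulrDr lerD // mulrCA.
by apply: ler_wpM2l; [exact: ltW|exact: conductance_cut].
Qed.

(** Apply [coarea] to the square of [f]. The AM-GM weights let the left side absorb a term equal to
    half of [phi * dnorm g f]. *)
Lemma cheeger_small_support f : (forall x, 0 <= f x) ->
  ((vol g [set x | (0 < f x)%R]).*2 <= vol g finset.setT)%N ->
  dnorm g f <= 2 / phi ^+ 2 * energy g f f.
Proof.
move=> f0 volf; have phi0 := conductance_gt0; have phi_neq0 := lt0r_neq0 phi0.
have := @coarea (fun x => f x ^+ 2) (fun x => sqr_ge0 _).
have -> : [set x | (0 < f x ^+ 2)%R] = [set x | (0 < f x)%R].
  apply/setP => x; rewrite !inE.
  by rewrite !lt0r sqrf_eq0 sqr_ge0 f0.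
move=> /(_ volf); rewrite -[dsum g _]/(dnorm g f) => H.
(* AM-GM: |a^2 - b^2| <= (a - b)^2 / phi + phi (a + b)^2 / 4. *)
have amgm a b : 0 <= a -> 0 <= b ->
    `|a ^+ 2 - b ^+ 2| <= (phi^-1 - phi / 4) * (a - b) ^+ 2 + phi / 2 * (a ^+ 2 + b ^+ 2).
  move=> a0 b0; rewrite subr_sqr normrM (ger0_norm (addr_ge0 a0 b0)) -subr_ge0.
  have -> : (phi^-1 - phi / 4) * (a - b) ^+ 2 + phi / 2 * (a ^+ 2 + b ^+ 2)
      - `|a - b| * (a + b) = phi^-1 * (`|a - b| - phi / 2 * (a + b)) ^+ 2.
    have -> : phi^-1 * (`|a - b| - phi / 2 * (a + b)) ^+ 2 =
        phi^-1 * `|a - b| ^+ 2 - `|a - b| * (a + b) + phi / 4 * (a + b) ^+ 2 by field.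
    by rewrite real_normK ?num_real //; field.
  by rewrite mulr_ge0 ?sqr_ge0 // invr_ge0 ltW.
have : 2^-1 * \sum_x \sum_y (g x y)%:R * `|f x ^+ 2 - f y ^+ 2| <=
    (phi^-1 - phi / 4) * energy g f f + phi / 2 * dnorm g f.
  rewrite (dnormE _ g_sym) /energy ![_ * (2^-1 * _)]mulrCA -mulrDr.
  rewrite ler_wpM2l ?invr_ge0 ?ler0n // !mulr_sumr -big_split ler_sum // => x _.
  rewrite !mulr_sumr -big_split ler_sum // => y _ /=.
  case: (g x y); last by rewrite !mul0r !mulr0 addr0.
  by rewrite !mul1r -expr2 amgm.
move=> /(le_trans H) {}H.
rewrite mulrAC ler_pdivlMr ?exprn_gt0 //.
have -> : dnorm g f * phi ^+ 2 =
  2 * phi * (phi * dnorm g f - phi / 2 * dnorm g f) by field.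
have -> : 2 * energy g f f = 2 * phi * (phi^-1 * energy g f f) by field; rewrite gt_eqF.
rewrite ler_pM2l ?mulr_gt0 // lerBlDr (le_trans H) // lerD2r ler_wpM2r ?energy_ge0 //.
by rewrite gerBl divr_ge0 ?ltW.
Qed.

(** Take [f m] least among the values with at most half the volume strictly above. The largest value
    below it, if any, has more than half the volume above it, and the set below [f m] is the
    complement. *)
Lemma weighted_median f : exists c,
  ((vol g [set x | (c < f x)%R]).*2 <= vol g finset.setT)%N /\
  ((vol g [set x | (f x < c)%R]).*2 <= vol g finset.setT)%N.
Proof.
have /card_gt0P[z _] : (0 < #|V|)%N by exact: ltn_trans V_ge2.
pose P x := ((vol g [set y | (f x < f y)%R]).*2 <= vol g finset.setT)%N.
have [t _ t_max] := Order.TotalTheory.arg_maxP (P := xpredT) f (erefl : xpredT z).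
have Pt : P t.
  rewrite /P (_ : [set y | _] = finset.set0) ?/vol ?big_set0 //.
  by apply/setP => y; rewrite !inE; apply/negbTE; rewrite -leNgt; exact: t_max.
have [m Pm m_min] := Order.TotalTheory.arg_minP (P := P) f Pt.
exists (f m); split=> //; set S := [set x | _].
have [->|/finset.set0Pn[w wS]] := eqVneq S finset.set0; first by rewrite /vol big_set0.
have [l lS l_max] := Order.TotalTheory.arg_maxP (P := mem S) f wS.
have {}lS : f l < f m by have : l \in S := lS; rewrite inE.
have : ~~ P l by apply: contraTN lS => /m_min; rewrite -leNgt.
rewrite /P -ltnNge => volG; have SE : S = ~: [set y | (f l < f y)%R].
  apply/setP => y; rewrite !inE -leNgt; apply/idP/idP => [ym|yl].
    by apply: l_max; change (y \in S); rewrite inE.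
  exact: le_lt_trans lS.
have := volC [set y | (f l < f y)%R]; rewrite -SE => volE'; lia.
Qed.

(** Cut [f] at a weighted median into positive and negative parts, each supported on at most half
    the volume. Their norms add up, and their energies sum to at most that of [f]. *)
Lemma cheeger f : dvar g f <= 2 / phi ^+ 2 * energy g f f.
Proof.
have phi0 := conductance_gt0; have [c [volp voln]] := weighted_median f.
pose p x := Num.max (f x - c) 0; pose n x := Num.max (c - f x) 0.
have p0 x : 0 <= p x by rewrite le_max lexx orbT.
have n0 x : 0 <= n x by rewrite le_max lexx orbT.
have Np : dnorm g p <= 2 / phi ^+ 2 * energy g p p.
  apply: cheeger_small_support => //; congr (_.*2 <= _)%N: volp; congr (vol g _).
  by apply/setP => x; rewrite !inE lt_max ltxx orbF subr_gt0.
have Nn : dnorm g n <= 2 / phi ^+ 2 * energy g n n.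
  apply: cheeger_small_support => //; congr (_.*2 <= _)%N: voln; congr (vol g _).
  by apply/setP => x; rewrite !inE lt_max ltxx orbF subr_gt0.
apply: (le_trans (dvar_le_dnorm c f (total_deg_gt0 _ V_ge2 g_conn))).
have -> : dnorm g (fun x => f x - c) = dnorm g p + dnorm g n.
  rewrite /dnorm -big_split; apply: eq_bigr => x _ /=; rewrite -mulrDr; congr (_ * _).
  by rewrite /p /n; case: (leP (f x - c) 0); case: (leP (c - f x) 0) => ? ?; nra.
apply: (le_trans (lerD Np Nn)); rewrite -mulrDr ler_wpM2l //.
  by rewrite divr_ge0 ?ler0n // exprn_ge0 // ltW.
rewrite /energy -mulrDr ler_wpM2l ?invr_ge0 ?ler0n //.
rewrite -big_split ler_sum // => x _; rewrite -big_split ler_sum // => y _ /=.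
case: (g x y); last by rewrite !mul0r addr0.
(* Since [p] and [n] have disjoint supports, their increments along an edge never have the same
   sign, so the cross term is favourable. *)
rewrite !mul1r /p /n.
by case: (leP (f x - c) 0); case: (leP (c - f x) 0); case: (leP (f y - c) 0);
  case: (leP (c - f y) 0) => *; nra.
Qed.

End Cheeger.

(** * Effect of deleting one edge *)

Section RemoveEdge.
Variables (R : realType) (V : finType) (g : rel V) (u v : V).
Hypotheses (g_sym : symmetric g) (g_irr : irreflexive g) (uv_edge : g u v).

Let h := remove_edge g u v.

Implicit Types f k : V -> R.

Lemma edge_neq : u != v.
Proof. by apply: contraTneq uv_edge => ->; rewrite g_irr. Qed.

Lemma remove_edge_sym : symmetric h.
Proof. by move=> x y; rewrite /h /remove_edge g_sym finset.setUC. Qed.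

(** A form linear in the indicators, ready for summation: the two products are the two orientations
    of the edge, distinct since [u != v]. *)
Lemma remove_edgeE x y : (h x y)%:R =
  (g x y)%:R - (x == u)%:R * (y == v)%:R - (x == v)%:R * (y == u)%:R :> R.
Proof.
have uv := edge_neq; have vu : g v u by rewrite g_sym.
have -> : h x y = g x y && ~~ ((x == u) && (y == v) || (x == v) && (y == u)).
  rewrite /h /remove_edge; congr (_ && ~~ _); apply/eqP/idP => [E|].
    have uxy : u \in [set x; y] by rewrite E !inE eqxx.
    have vxy : v \in [set x; y] by rewrite E !inE eqxx orbT.
    move: uxy vxy uv; rewrite !inE => /orP[] /eqP-> /orP[] /eqP->;
      by rewrite !eqxx ?orbT.
  case/orP=> /andP[/eqP-> /eqP->] //.
  by rewrite finset.setUC.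
have : (x == u) && (y == v) ==> g x y.
  by apply/implyP => /andP[/eqP-> /eqP->].
have : (x == v) && (y == u) ==> g x y.
  by apply/implyP => /andP[/eqP-> /eqP->].
have : ~~ ((x == u) && (x == v)).
  by apply/negP => /andP[/eqP-> /eqP]; apply/eqP.
case: (x == u); case: (y == v); case: (x == v); case: (y == u);
  case: (g x y) => //= _ _ _; ring.
Qed.

Lemma sum_delta (z : V) f : \sum_x (x == z)%:R * f x = f z.
Proof.
rewrite (bigD1 z) //= eqxx mul1r big1 ?addr0 // => x /negPf ->.
by rewrite mul0r.
Qed.

Lemma deg_remove_edge x :
  (deg h x)%:R = (deg g x)%:R - (x == u)%:R - (x == v)%:R :> R.
Proof.
rewrite !degE; under eq_bigr do rewrite remove_edgeE.
rewrite !sumrB; congr (_ - _ - _); under eq_bigr do rewrite mulrC;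
  exact: (sum_delta _ (fun=> _)).
Qed.

Lemma dnorm_remove_edge f : dnorm h f = dnorm g f - f u ^+ 2 - f v ^+ 2.
Proof.
rewrite /dnorm; under eq_bigr do rewrite deg_remove_edge !mulrBl.
by rewrite !sumrB !(sum_delta _ (fun x => f x ^+ 2)).
Qed.

Lemma energy_remove_edge f k :
  energy h f k = energy g f k - (f u - f v) * (k u - k v).
Proof.
rewrite /energy.
under eq_bigr do under eq_bigr do rewrite remove_edgeE !mulrBl.
under eq_bigr do rewrite !sumrB.
rewrite !sumrB !mulrBr -addrA -opprD; congr (_ - _).
(* Both orientations of the edge give the same product, and the factor one half leaves one copy. *)
have half z t : \sum_x \sum_y (x == z)%:R * (y == t)%:R * (f x - f y) * (k x - k y) =
    (f z - f t) * (k z - k t).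
  rewrite -(sum_delta z (fun x => (f x - f t) * (k x - k t))).
  apply: eq_bigr => x _;
  rewrite -(sum_delta t (fun y => (f x - f y) * (k x - k y))) mulr_sumr.
  by apply: eq_bigr => y _; rewrite !mulrA.
by rewrite !half; field.
Qed.

End RemoveEdge.

(** * Comparison of the two graphs along the flag [U0], [U], [W] *)

Theorem corollary5p10 (R : realType) (V : finType) (g : rel V)
    (g_sym : symmetric g) (g_irr : irreflexive g)
    (V_ge2 : (2 <= #|V|)%N) (g_conn : connected_graph g)
    (u v : V) (uv_edge : g u v) (H_conn : connected_graph (remove_edge g u v))
    (j j' : V) :
  (kemeny R g j + (1 / 2 - 2 / conductance R g ^+ 2)%:E
     <= kemeny R (remove_edge g u v) j')%E.
Proof.
have phi0 := conductance_gt0 R g_sym V_ge2 g_conn.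
set phi := conductance R g in phi0 *.
pose h := remove_edge g u v; rewrite -/h in H_conn *.
have h_sym : symmetric h by exact: remove_edge_sym.
have Tg := total_deg_gt0 R V_ge2 g_conn; have Th := total_deg_gt0 R V_ge2 H_conn.
have hE f k : energy h f k = energy g f k - (f u - f v) * (k u - k v) :> R.
  exact: energy_remove_edge.
have hN f : dnorm h f = dnorm g f - f u ^+ 2 - f v ^+ 2 :> R.
  exact: dnorm_remove_edge.
pose W (f : V -> R) := f u + f v = 0.
pose U f := W f /\ dsum h f = 0.
pose U0 f := U f /\ f u = 0.
have dsum_lin c (f k : V -> R) :
    dsum h (fun x => c * f x + k x) = c * dsum h f + dsum h k.
  rewrite /dsum mulr_sumr -big_split; apply: eq_bigr => x _ /=; ring.
have ev_lin c (f k : V -> R) : c * f u + k u = c * f u + k u by [].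
have W_sub : linear_subspace W.
  split=> [|c f k fW kW]; first by rewrite /W addr0.
  by rewrite /W addrACA -mulrDr fW kW mulr0 addr0.
have U_sub : linear_subspace U by exact: subspace_ker dsum_lin.
have U0_sub : linear_subspace U0 by exact: (@subspace_ker _ _ U (fun f => f u)).
have W_def (e : rel V) : connected_graph e -> definite_on e W.
  move=> e_conn f fW /(energy_eq0 e_conn) f_const x.
  by move: fW; rewrite /W !(f_const _ x); lra.
have U_def (e : rel V) : connected_graph e -> definite_on e U.
  by move=> e_conn f [Wf _]; exact: W_def.
have W_shift f : exists c, W (fun x => f x - c).
  by exists ((f u + f v) / 2); rewrite /W; field.
have [s sg] : exists s, expands g U0 s.
  by apply: expands_exists => // f [Uf _]; exact: U_def.
have U0v f : U0 f -> f v = 0.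
  by move=> [[fW _] fu]; move: fW; rewrite /W fu add0r.
(* Functions in [U0] vanish at both ends of the edge, so the two energies agree on them. *)
have sh : expands h U0 s.
  case: sg => sU0 sE; split=> // f U0f x; rewrite (sE f U0f x).
  apply: eq_big_seq => a /sU0 U0a.
  by rewrite !hE (U0v _ U0a) (U0v _ U0f) U0a.2 U0f.2 !subrr !mulr0 !subr0.
have [b [Ub b_codim b_orth]] := expands_normal U_sub ev_lin sg.
have b_orth_h f : U f -> f u = 0 -> energy h b f = 0.
  move=> Uf fu; rewrite hE b_orth // fu (U0v f) //; ring.
have bg := expands_cons (U_def _ g_conn) sg Ub b_codim b_orth.
have bh := expands_cons (U_def _ H_conn) sh Ub b_codim b_orth_h.
(* The last vector is made orthogonal to [U] separately: [c] for the energy of [g], [d] for that of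
   [h]. *)
have [c [Wc c_codim c_orth]] := expands_normal W_sub dsum_lin bg.
have [d [Wd d_codim d_orth]] := expands_normal W_sub dsum_lin bh.
have cg := expands_cons (W_def _ g_conn) bg Wc c_codim c_orth.
have dh := expands_cons (W_def _ H_conn) bh Wd d_codim d_orth.
rewrite (kemenyE g_sym V_ge2 g_conn _ W_shift cg).
rewrite (kemenyE h_sym V_ge2 H_conn _ W_shift dh).
rewrite !big_cons -EFinD lee_fin.
(* The denominators agree; since [dsum h a = 0], only the numerator for [g] has a square
   subtracted. *)
have s_le : \sum_(a <- s) dvar g a / energy g a a <=
            \sum_(a <- s) dvar h a / energy h a a.
  rewrite big_seq [leRHS]big_seq; apply: ler_sum => a as_.
  have [[Wa Sa] au] := sg.1 a as_; have av := U0v a (sg.1 a as_).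
  rewrite hE au av subrr mulr0 subr0 ler_wpM2r ?invr_ge0 ?energy_ge0 //.
  rewrite /dvar Sa hN au av expr0n /= mul0r !subr0.
  by rewrite lerBlDr lerDl divr_ge0 ?sqr_ge0 // ltW.
have c_le : dvar g c / energy g c c <= 2 / phi ^+ 2.
  have [->|Ec] := eqVneq (energy g c c) 0.
    by rewrite invr0 mulr0 divr_ge0 ?ler0n // exprn_ge0 // ltW.
  by rewrite ler_pdivrMr ?lt0r ?Ec ?energy_ge0 //; exact: cheeger.
have b_le : dvar g b / energy g b b <= dvar h b / energy h b b.
  (* Zero energy forces [b] to be zero, and both quotients are then 0. *)
  have [b0|Eb] := eqVneq (energy h b b) 0.
    have -> : b = fun=> 0 by apply/funext => x; exact: (U_def _ H_conn _ Ub b0).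
    by rewrite !energy0l !invr0 !mulr0.
  have Ehb : 0 < energy h b b by rewrite lt0r Eb energy_ge0.
  have bv : b v = - b u by case: Ub => /eqP; rewrite addrC addr_eq0 => /eqP.
  have Nb : dvar h b = dnorm g b - 2 * b u ^+ 2.
    by rewrite /dvar Ub.2 hN bv; field; rewrite gt_eqF.
  have Ebh : energy h b b = energy g b b - 4 * b u ^+ 2 by rewrite hE bv; ring.
  have Egb : 0 < energy g b b.
    by move: Ehb; rewrite Ebh; have := sqr_ge0 (b u); lra.
  have EN := energy_le_dnorm b g_sym.
  rewrite ler_pdivrMr // mulrAC ler_pdivlMr // Nb Ebh.
  apply: (@le_trans _ _ (dnorm g b * (energy g b b - 4 * b u ^+ 2))).
    rewrite -Ebh ler_wpM2r ?energy_ge0 // /dvar.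
    by rewrite lerBlDr lerDl divr_ge0 ?sqr_ge0 // ltW.
  (* After cross-multiplication what remains is [EN] multiplied by [2 * t]. *)
  have := sqr_ge0 (b u); move: (b u ^+ 2) EN => t EN t0; nra.
have d_ge : 1 / 2 <= dvar h d / energy h d d.
  (* The quotient would be 0 if [d] were a padding zero vector. A neighbour [y] of [u] in [h]
     excludes this: it is neither [u] nor [v], so its indicator lies in [W], and [dsum h] of the
     indicator is the positive degree of [y]. *)
  have [y huy] : exists y, h u y.
    have := connected_deg_gt0 u V_ge2 H_conn.
    by case/card_gt0P => y; rewrite inE => huy; exists y.
  have yu : u != y.
    by apply: contraTneq huy => <-; rewrite /h /remove_edge g_irr.
  have yv : v != y.
    by apply: contraTneq huy => <-; rewrite /h /remove_edge eqxx andbF.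
  have Ed : energy h d d != 0.
    apply/eqP => d0; have dz := W_def _ H_conn _ Wd d0.
    pose f x : R := (x == y)%:R.
    have Wf : W f by rewrite /W /f (negPf yu) (negPf yv) addr0.
    have [e [_]] := d_codim f Wf.
    rewrite dsum_lin (_ : dsum h d = 0); last first.
      by rewrite /dsum big1 // => x _; rewrite dz mulr0.
    rewrite mulr0 add0r /dsum; under eq_bigr do rewrite mulrC.
    rewrite (sum_delta y (fun x => (deg h x)%:R)) => /eqP.
    by rewrite pnatr_eq0 -leqn0 leqNgt connected_deg_gt0.
  rewrite ler_pdivlMr ?lt0r ?Ed ?energy_ge0 //.
  by have := energy_le_dvar d h_sym Th; lra.
lra.
Qed.
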